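(* For all sufficiently large positive integers $n$, $$\frac{n^2}{6}-\frac{5n}{2\sqrt3}+3<H(n)\le\binom{n}{2}.$$ Thus $H(n)=\Theta\left(\binom{n+1}{3}-\binom{n}{3}\right)=\Theta(n^2)$.
   Context: For a $3$-element subset $T=\{a,b,c\}$ of a totally ordered set with $a<b<c$ and a $2$-element subset $e$, $[T:e]$ is $1$ if $e=\{a,b\}$ or $\{b,c\}$, $-1$ if $e=\{a,c\}$, $0$ if $e\not\subset T$. For a nonempty finite family $\mathcal T$ of $3$-element subsets of a totally ordered set, the support graph $\Gamma_0(\mathcal T)$ has vertex set $\bigcup_{T\in\mathcal T}T$ and edges the pairs contained in some member of $\mathcal T$; $\delta_{1,\mathcal T}$ is the $\mathcal T\times E(\Gamma_0(\mathcal T))$ matrix with entries $[T:e]$, and $\lambda(\mathcal T)$ is the smallest positive eigenvalue of $\delta_{1,\mathcal T}^T\delta_{1,\mathcal T}$. For positive integers $t$, $\phi(t)=\max_{|\mathcal T|=t}\lambda(\mathcal T)$. For an integer $n\ge 3$, $H(n)=\min\{s\in\mathbb N:\phi(\binom{n}{3}+s)>n-1\}$. *)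

(* Defs.v *)
From HB Require Import structures.
From mathcomp Require Import all_boot all_order all_algebra finmap.
From mathcomp Require Import all_classical all_reals all_analysis.

Set Implicit Arguments.
Unset Strict Implicit.
Unset Printing Implicit Defensive.

Import Order.TTheory GRing.Theory Num.Theory.
Import numFieldNormedType.Exports.

Local Open Scope classical_set_scope.
Local Open Scope ring_scope.

(* The least (greatest) element of A; x0 is the default value when
   A has no such element. *)
Definition set_min (d : Order.disp_t) (T : porderType d) (x0 : T) (A : set T) : T :=
  xget x0 (A `&` lbound A).

Definition set_max (d : Order.disp_t) (T : porderType d) (x0 : T) (A : set T) : T :=
  xget x0 (A `&` ubound A).

Section TripleFamilies.
Variables (R : realType) (d : Order.disp_t) (V : orderType d).
Local Open Scope fset_scope.

(* [T : e], meant for a 3-element T and a 2-element e. *)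
Definition incidence (T e : {fset V}) : R :=
  if sort <=%O (enum_fset T) is [:: a; b; c] then
    if (e == [fset a; b]) || (e == [fset b; c]) then 1
    else if e == [fset a; c] then -1
    else 0
  else 0.

Definition triple_family (F : {fset {fset V}}) : Prop :=
  forall T, T \in F -> #|` T| = 3%N.

Definition support_vertices (F : {fset {fset V}}) : {fset V} :=
  \bigcup_(T <- enum_fset F) T.

Definition support_edges (F : {fset {fset V}}) : {fset {fset V}} :=
  [fset e in fpowerset (support_vertices F)
     | (#|` e| == 2%N) && has (fun T => e `<=` T) (enum_fset F)].

Definition delta1 (F : {fset {fset V}}) : 'M[R]_(#|{: F}|, #|{: support_edges F}|) :=
  \matrix_(i, j) incidence (val (enum_val i)) (val (enum_val j)).

Definition lambda (F : {fset {fset V}}) : R :=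
  set_min 0 [set x : R | eigenvalue ((delta1 F)^T *m delta1 F) x /\ 0 < x]%classic.

End TripleFamilies.

Definition phi (R : realType) (t : nat) : R :=
  set_max 0 [set x : R | exists (d : Order.disp_t) (V : orderType d)
                                (F : {fset {fset V}}),
      [/\ triple_family F, #|` F|%fset = t & x = lambda R F]].

(* The minimum ranges over positive s: for s = 0 the family of all triples of an
   n-element set has all its positive eigenvalues equal to n > n - 1. *)
Definition Hmin (R : realType) (n : nat) : nat :=
  set_min 0%N [set s : nat | (0 < s)%N /\ n%:R - 1 < phi R ('C(n, 3) + s)].

(* Main.v *)
Require Import Defs.
From HB Require Import structures.
From mathcomp Require Import all_boot all_order all_algebra finmap.
From mathcomp Require Import all_classical all_reals all_analysis.
From mathcomp Require Import spectral sesquilinear complex.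
From mathcomp Require Import ring lra zify.

(* Write M for the Gram matrix of delta_1 and deg e for the number of triples
   containing the edge e. Since (M ^ 2)_ee <= deg e ^ 2 + 2 deg e and M_ee = deg e,
   the spectral theorem gives lambda <= deg e + 2 for every edge e. If lambda > n - 1
   then all edge degrees are at least n - 2, so every vertex lies in at least
   (n - 1)(n - 2) / 2 triples. A family of more than C(n, 3) triples has at least
   n + 1 vertices, so a double count bounds its excess over C(n, 3) from below by
   (n - 1)(n - 2) / 6.
   The same estimate shows that no family of C(n + 1, 3) triples has
   lambda > n + 1, and the complete family on n + 1 vertices attains n + 1 because
   M = (n + 1) - d_0 d_0^T there, with d_0 the vertex coboundary; hence
   H(n) <= C(n, 2). *)

Set Implicit Arguments.
Unset Strict Implicit.
Unset Printing Implicit Defensive.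

Import Order.TTheory GRing.Theory Num.Theory.
Import numFieldNormedType.Exports.

Local Open Scope classical_set_scope.
Local Open Scope ring_scope.

(** Write [A] as [invmx P *m diag_mx D *m P] with [P] unitary over the complex numbers. Then the
    difference of the two sides is the sum over k of [|P k i| ^ 2 * D_k * (D_k - l)]. Each term is
    nonnegative: a positive [D_k] is at least [l], and for [D_k <= 0] both of the last factors are
    nonpositive since [l >= 0]. *)
Lemma sym_diag_sqr_ge (R : rcfType) (n : nat) (A : 'M[R]_n) (l : R) (i : 'I_n) :
    A^T = A -> 0 <= l ->
    (forall x, eigenvalue A x -> 0 < x -> l <= x) ->
  l * A i i <= (A *m A) i i.
Proof.
move=> symA l_ge0 lA.
pose f := real_complex R; pose B := map_mx f A.
have fR x : f x \is Num.real by apply/complex_realP; exists x.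
have hermB : B \is hermsymmx.
  apply: realsym_hermsym; last by apply/mxOverP => j k; rewrite mxE.
  by apply/is_hermitianmxP; rewrite expr0 scale1r map_mx_id // /B map_trmx symA.
pose P := spectralmx B; pose D := spectral_diag B.
have /orthomx_spectralP BE := hermitian_normalmx hermB.
have Pu : P \in unitmx := spectral_unit B.
have PV : invmx P = map_mx Num.conj P^T := invmx_unitary (spectral_unitarymx B).
have PB : P *m B = diag_mx D *m P by rewrite {1}BE -/P -/D !mulmxA mulmxV // mul1mx.
have BBE : B *m B = invmx P *m diag_mx (\row_k (D 0 k * D 0 k)) *m P.
  by rewrite {1}BE -/P -/D -(mulmxA _ P B) PB !mulmxA -(mulmxA _ (diag_mx D) (diag_mx D)) mulmx_diag.
have entry E : (invmx P *m diag_mx E *m P) i i = \sum_k `|P k i| ^+ 2 * E 0 k.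
  rewrite PV mul_mx_diag mxE; apply: eq_bigr => k _.
  by rewrite !mxE normCK mulrAC [_^* * _]mulrC.
have eigD k : eigenvalue B (D 0 k).
  apply/eigenvalueP; exists (row k P).
    by rewrite -row_mul PB; apply/rowP => j; rewrite mul_diag_mx !mxE.
  apply/eqP => Pk0; have := congr1 (row k) (mulmxV Pu).
  rewrite row_mul Pk0 mul0mx => /rowP/(_ k); rewrite !mxE eqxx => /esym/eqP.
  by rewrite oner_eq0.
have realD k : D 0 k \is Num.real.
  by have /mxOverP/(_ 0 k) := hermitian_spectral_diag_real hermB.
rewrite -subr_ge0 -ler0c rmorphB rmorphM /= -/f.
have -> : f (A i i) = B i i by rewrite mxE.
have -> : f ((A *m A) i i) = (B *m B) i i by rewrite -map_mxM [RHS]mxE.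
rewrite BBE {1}BE !entry mulr_sumr -sumrB; apply: sumr_ge0 => k _.
rewrite mxE [f l * _]mulrCA -mulrBr mulr_ge0 ?exprn_ge0 // -mulrBl.
(* Being real, the diagonal entry is the image of some [x], which is then an eigenvalue of [A]
   itself. *)
have /complex_realP[x Dx] := realD k.
have := eigD k; rewrite Dx -/f /B eigenvalue_map => /lA lx.
rewrite -rmorphB -rmorphM /= ler0c.
case: (ltrP 0 x) => [x_gt0|x_le0].
  by rewrite mulr_ge0 ?subr_ge0 ?(ltW x_gt0) // lx.
by rewrite mulr_le0 // subr_le0 (le_trans x_le0).
Qed.

(** * Pairs inside triples, and edge degrees *)

Section Triples.
Local Open Scope fset_scope.
Local Open Scope ring_scope.

Lemma card_fset_draws (K : choiceType) (S : {fset K}) (k : nat) :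
  #|` [fset T in fpowerset S | #|` T| == k]| = 'C(#|` S|, k).
Proof.
rewrite [in RHS]cardfE -card_draws [RHS]cardE.
pose X := [fset T in fpowerset S | #|` T| == k].
have XE T : (T \in X) = (T `<=` S) && (#|` T| == k).
  by rewrite !inE fpowersetE.
rewrite -/X -(size_map (fsub S)).
apply/perm_size/uniq_perm; last 2 first.
- exact: enum_uniq.
- move=> A; rewrite mem_enum inE; apply/mapP/idP => [[T]|/eqP Ak].
    by rewrite XE => /andP[TS Tk] ->; rewrite card_fsub.
  exists [fsetval x in A]; last by rewrite FSetK.
  have AS : [fsetval x in A] `<=` S.
    by apply/fsubsetP => x /in_fset_valP[].
  by rewrite XE AS -(card_fsub AS) FSetK Ak /=.
rewrite map_inj_in_uniq ?fset_uniq // => T U.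
by rewrite !XE => /andP[TS _] /andP[US _]; apply: fsub_inj.
Qed.

Lemma big_enum_fset (W : nmodType) (K : choiceType) (A : {fset K}) (G : K -> W) :
  \sum_(i < #|{: A}|) G (val (enum_val i)) = \sum_(x <- A) G x.
Proof. by rewrite big_seq_fsetE -(big_enum_val (fun x : A => G (val x))). Qed.

Lemma sum_mem_fset (K : choiceType) (A B : {fset K}) : B `<=` A ->
  (\sum_(x <- A) (x \in B : nat))%N = #|` B|.
Proof.
move=> BA; rewrite -(big_fset_incl _ BA) /=; last by move=> x _ /negPf->.
rewrite card_fset_sum1 big_seq [RHS]big_seq; apply: eq_bigr => x xB.
by rewrite xB.
Qed.

Variables (d : Order.disp_t) (V : orderType d).
Implicit Types (T e : {fset V}) (F : {fset {fset V}}).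

Lemma sorted_tripleE T : #|` T| = 3 -> exists a b c,
  [/\ (a < b)%O, (b < c)%O, sort <=%O (enum_fset T) = [:: a; b; c]
    & T = [fset a; b; c]].
Proof.
move=> T3.
have sz : size (sort <=%O (enum_fset T)) = 3 by rewrite size_sort.
have srt : sorted <%O (sort <=%O (enum_fset T)).
  by rewrite sort_lt_sorted fset_uniq.
case E : (sort _ _) sz srt => [|a [|b [|c []]]] //= _ /and3P[ab bc _].
exists a, b, c; split => //; apply/fsetP => x.
by rewrite -(mem_sort <=%O) E !inE orbA.
Qed.

Lemma sorted_pairE e : #|` e| = 2 -> exists a b, (a < b)%O /\ e = [fset a; b].
Proof.
move=> e2.
have sz : size (sort <=%O (enum_fset e)) = 2 by rewrite size_sort.
have srt : sorted <%O (sort <=%O (enum_fset e)).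
  by rewrite sort_lt_sorted fset_uniq.
case E : (sort _ _) sz srt => [|a [|b []]] //= _ /andP[ab _].
exists a, b; split => //; apply/fsetP => x.
by rewrite -(mem_sort <=%O) E !inE.
Qed.

Lemma pair_in_triple e (a b c : V) : #|` e| = 2 -> e `<=` [fset a; b; c] ->
  [\/ e = [fset a; b], e = [fset b; c] | e = [fset a; c]].
Proof.
move=> /sorted_pairE[x [y [xy ->]]]; rewrite fsubUset !fsub1set !inE.
move/lt_eqF: xy => xy /andP[]; move: xy.
by move=> xy /orP[/orP[]|] /eqP Ex /orP[/orP[]|] /eqP Ey; move: xy;
  rewrite Ex Ey ?eqxx // => _; [constructor 1|constructor 3|constructor 1
    |constructor 2|constructor 3|constructor 2]; rewrite // fsetUC.
Qed.

Lemma incidence_sqr (R : realType) T e : #|` T| = 3 -> #|` e| = 2 ->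
  incidence R T e ^+ 2 = (e `<=` T)%:R.
Proof.
move=> /sorted_tripleE[a [b [c [ab bc sT TE]]]] e2.
rewrite /incidence sT TE; case: ifPn => [/orP[] /eqP->|].
- by rewrite expr1n fsubsetUl.
- by rewrite expr1n fsubUset !fsub1set !inE !eqxx !orbT.
rewrite negb_or => /andP[/eqP eab /eqP ebc]; case: eqP => [->|eac].
  by rewrite sqrrN expr1n fsubUset !fsub1set !inE !eqxx !orbT.
rewrite expr0n; case: (boolP (e `<=` _)) => //= /(pair_in_triple e2).
by case.
Qed.

(** Source of the constant 2 in the eigenvalue bound: a triple through an edge contains at most two
    further edges. *)
Lemma pairs_in_triple_count (s : seq {fset V}) T : uniq s ->
    (forall e, e \in s -> #|` e| = 2) -> #|` T| = 3 ->
  (count (fun e => e `<=` T) s <= 3)%N.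
Proof.
move=> us s2 /sorted_tripleE[a [b [c [_ _ _ ->]]]].
rewrite -size_filter -[3%N]/(size [:: [fset a; b]; [fset b; c]; [fset a; c]]).
apply: uniq_leq_size => [|e]; first exact: filter_uniq.
rewrite mem_filter => /andP[eT /s2 e2].
by rewrite !inE; case: (pair_in_triple e2 eT) => ->; rewrite eqxx ?orbT.
Qed.

Lemma pairsU_card_gt2 e e' : #|` e| = 2 -> #|` e'| = 2 -> e != e' ->
  (2 < #|` e `|` e'|)%N.
Proof.
move=> e2 e'2 ee'; rewrite ltnNge; apply: contra ee' => U2.
have UE : e `|` e' = e by apply/esym/eqP; rewrite eqEfcard fsubsetUl e2.
by rewrite eq_sym eqEfcard e2 e'2 -UE fsubsetUr.
Qed.

(** The union of two distinct pairs already has at least three elements, so it fills the triple.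
    Hence at most one triple contributes to an off-diagonal Gram entry. *)
Lemma two_pairs_in_triple T e e' : #|` T| = 3 -> #|` e| = 2 -> #|` e'| = 2 ->
  e != e' -> e `<=` T -> e' `<=` T -> T = e `|` e'.
Proof.
move=> T3 e2 e'2 ee' eT e'T; apply/esym/eqP.
by rewrite eqEfcard fsubUset eT e'T T3 /= pairsU_card_gt2.
Qed.

Definition edge_degree F e := count (fun T => e `<=` T) (enum_fset F).

Lemma support_edgeP F e : reflect
  (#|` e| = 2 /\ exists2 T, T \in F & e `<=` T) (e \in support_edges F).
Proof.
apply: (iffP idP); rewrite !inE fpowersetE.
  by case/and3P=> _ /eqP-> /hasP.
case=> -> [T TF eT]; rewrite eqxx; apply/and3P; split=> //; last first.
  by apply/hasP; exists T.
by rewrite (fsubset_trans eT) // (bigfcup_sup _ TF).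
Qed.

Lemma support_vertexP F v :
  reflect (exists2 T, T \in F & v \in T) (v \in support_vertices F).
Proof.
by apply: (iffP (bigfcupP _ _ _ _)) => [[T /andP[TF _] vT]|[T TF vT]];
  exists T; rewrite ?TF.
Qed.

Lemma edge_degreeE F e : edge_degree F e = (\sum_(T <- F) (e `<=` T : nat))%N.
Proof. by rewrite /edge_degree -sum1_count big_mkcond. Qed.

Lemma edge_degree_gt0 F e :
  (0 < edge_degree F e)%N = has (fun T => e `<=` T) (enum_fset F).
Proof. by rewrite -has_count. Qed.

End Triples.

(** * The Gram matrix of [delta1] and the bound of [lambda] by edge degrees *)

Section Laplacian.
Local Open Scope fset_scope.
Local Open Scope ring_scope.
Variables (R : realType) (d : Order.disp_t) (V : orderType d).
Implicit Types (T e : {fset V}) (F : {fset {fset V}}).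

(** Indexing by the pairs themselves, instead of by ordinals, allows sums over finite sets of
    edges. *)
Definition gram_entry F e e' : R :=
  \sum_(T <- F) incidence R T e * incidence R T e'.

Lemma gram_entryE F j k : ((delta1 R F)^T *m delta1 R F) j k =
  gram_entry F (val (enum_val j)) (val (enum_val k)).
Proof.
rewrite mxE /gram_entry -big_enum_fset; apply: eq_bigr => i _.
by rewrite !mxE.
Qed.

Lemma gram_entry_diag F e : triple_family F -> #|` e| = 2%N ->
  gram_entry F e e = (edge_degree F e)%:R.
Proof.
move=> F3 e2; rewrite edge_degreeE natr_sum /gram_entry.
rewrite big_seq [RHS]big_seq; apply: eq_bigr => T TF.
by rewrite -expr2 incidence_sqr ?(F3 T).
Qed.

Lemma gram_entry_off F e e' : triple_family F -> #|` e| = 2%N -> #|` e'| = 2%N ->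
  e != e' ->
  gram_entry F e e' = if e `|` e' \in F then
    incidence R (e `|` e') e * incidence R (e `|` e') e' else 0.
Proof.
move=> F3 e2 e'2 ee'.
have z T : T \in F -> T != e `|` e' -> incidence R T e * incidence R T e' = 0.
  (* Squaring removes the signs, so that the product is nonzero only if [T] contains both pairs. *)
  move=> TF TU; apply/eqP; rewrite -sqrf_eq0 exprMn !incidence_sqr ?(F3 T) //.
  rewrite -natrM mulnb pnatr_eq0 eqb0; apply: contra TU => /andP[eT e'T].
  by apply/eqP/two_pairs_in_triple => //; apply: F3.
rewrite /gram_entry; case: ifPn => UF.
  rewrite (bigD1_seq _ UF) ?fset_uniq //= big_seq_cond big1 ?addr0 //.
  by move=> T /andP[TF TU]; apply: z.
rewrite big_seq big1 // => T TF; apply: z => //.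
by apply: contraNneq UF => <-.
Qed.

Lemma gram_entry_off_sqr F e e' : triple_family F ->
    #|` e| = 2%N -> #|` e'| = 2%N -> e != e' ->
  gram_entry F e e' ^+ 2 <= \sum_(T <- F) ((e `<=` T) && (e' `<=` T))%:R.
Proof.
move=> F3 e2 e'2 ee'; rewrite gram_entry_off //; case: ifPn => UF; last first.
  by rewrite expr0n sumr_ge0.
rewrite (bigD1_seq _ UF) ?fset_uniq //= exprMn !incidence_sqr ?(F3 _ UF) //.
by rewrite -natrM mulnb lerDl sumr_ge0.
Qed.

(** The diagonal entry gives the squared degree. Each triple through [e] accounts for at most two
    other edges, so the remaining entries give at most twice the degree. *)
Lemma sum_gram_entry_sqr F e : triple_family F -> e \in support_edges F ->
  \sum_(e' <- support_edges F) gram_entry F e e' ^+ 2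
    <= (edge_degree F e)%:R ^+ 2 + 2 * (edge_degree F e)%:R.
Proof.
move=> F3 eE; have [e2 _] := support_edgeP _ _ eE.
have E2 e' : e' \in support_edges F -> #|` e'| = 2%N.
  by case/support_edgeP.
rewrite (bigD1_seq _ eE) ?fset_uniq //= gram_entry_diag // lerD2l.
pose G e' : R := \sum_(T <- F) ((e `<=` T) && (e' `<=` T))%:R.
apply: (@le_trans _ _ (\sum_(e' <- support_edges F | e' != e) G e')).
  rewrite big_seq_cond [leRHS]big_seq_cond; apply: ler_sum => e' /andP[e'E e'e].
  by apply: gram_entry_off_sqr; rewrite ?E2 // eq_sym.
rewrite exchange_big /= edge_degreeE natr_sum mulr_sumr.
rewrite big_seq [leRHS]big_seq; apply: ler_sum => T TF.
case: (boolP (e `<=` T)) => eT /=; last by rewrite big1 ?mulr0.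
rewrite mulr1 -natr_sum ler_nat /=.
(* Of the at most three edges inside [T], one is [e] itself. *)
have := pairs_in_triple_count (fset_uniq (support_edges F)) E2 (F3 _ TF).
rewrite -sum1_count big_mkcond (bigD1_seq _ eE) ?fset_uniq //= eT.
rewrite add1n ltnS; apply: leq_trans; apply: leq_sum => e' _.
by case: (e' `<=` T).
Qed.

(** At the diagonal position of [e], the spectral inequality reads [l * deg <= deg ^ 2 + 2 * deg],
    and the degree of a support edge is positive. *)
Lemma lambda_le_degree F e : triple_family F -> e \in support_edges F ->
  lambda R F <= (edge_degree F e)%:R + 2.
Proof.
move=> F3 eE; rewrite /lambda /set_min.
(* In the second case [lambda] takes its default value 0, and the bound is immediate. *)
case: xgetP => [l _ [[_ l_gt0] lmin]|_]; last by rewrite addr_ge0.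
have [e2 [T TF eT]] := support_edgeP _ _ eE.
pose j : 'I_#|{: support_edges F}| := enum_rank [` eE].
have jE : val (enum_val j) = e by rewrite enum_rankK.
set M := (delta1 R F)^T *m delta1 R F in lmin.
have /(_ l j) gap := @sym_diag_sqr_ge R _ M.
have {gap} : l * M j j <= (M *m M) j j.
  apply: gap; rewrite ?ltW //; first by rewrite /M trmx_mul trmxK.
  by move=> x Mx x_gt0; apply: lmin.
have -> : (M *m M) j j = \sum_(e' <- support_edges F) gram_entry F e e' ^+ 2.
  rewrite mxE -big_enum_fset; apply: eq_bigr => k _.
  by rewrite !gram_entryE jE expr2; congr (_ * _); apply: eq_bigr => U _; rewrite mulrC.
move=> /le_trans/(_ (sum_gram_entry_sqr F3 eE)).
rewrite gram_entryE jE gram_entry_diag // expr2 -mulrDl ler_pM2r // ltr0n.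
by rewrite edge_degree_gt0; apply/hasP; exists T.
Qed.

End Laplacian.

(** * Double counting when every edge has degree at least [k] *)

Section Counting.
Local Open Scope fset_scope.
Local Open Scope nat_scope.
Variables (d : Order.disp_t) (V : orderType d) (F : {fset {fset V}}) (k : nat).
Hypothesis F3 : triple_family F.
Hypothesis degF : forall e, e \in support_edges F -> k <= edge_degree F e.
Let S := support_vertices F.

Lemma sub_support T : T \in F -> T `<=` S.
Proof. by move=> TF; apply: bigfcup_sup TF _. Qed.

(** Count the pairs of a triple through [v] and another vertex [u] of it; each such triple has two
    choices of [u]. *)
Lemma sum_link_degree v :
  \sum_(u <- S `\ v) edge_degree F [fset v; u]
    = 2 * \sum_(T <- F) (v \in T : nat).
Proof.
under eq_bigr do rewrite edge_degreeE.
rewrite exchange_big big_distrr /= big_seq [RHS]big_seq; apply: eq_bigr => T TF.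
under eq_bigr do rewrite fsubUset !fsub1set.
case vT: (v \in T); last by rewrite big1.
have TS := sub_support TF.
have -> : \sum_(u <- S `\ v) (true && (u \in T) : nat) =
          \sum_(u <- S `\ v) (u \in T `\ v : nat).
  by rewrite big_seq [RHS]big_seq; apply: eq_bigr => u; rewrite !inE => /andP[->].
rewrite sum_mem_fset ?fsetSD //.
by have := F3 TF; rewrite (cardfsD1 v) vT add1n => -[->].
Qed.

(** Fix an edge from [v] to [u]. The third vertices of its at least [k] triples are distinct
    neighbours of [v], and [u] is one more. *)
Lemma link_vertices_ge v : v \in S ->
  k < \sum_(u <- S `\ v) (0 < edge_degree F [fset v; u] : nat).
Proof.
case/support_vertexP=> T0 T0F vT0.
have /fset0Pn[u] : T0 `\ v != fset0.
  by rewrite -cardfs_gt0; have := F3 T0F; rewrite (cardfsD1 v) vT0 add1n => -[->].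
rewrite !inE => /andP[uv uT0].
have vu : [fset v; u] \in support_edges F.
  apply/support_edgeP; split; first by rewrite cardfs2 eq_sym uv.
  by exists T0; rewrite // fsubUset !fsub1set vT0.
have uS : u \in S `\ v by rewrite !inE uv (fsubsetP (sub_support T0F)).
have deg_gt0 : 0 < edge_degree F [fset v; u].
  rewrite edge_degree_gt0; apply/hasP; exists T0 => //.
  by rewrite fsubUset !fsub1set vT0.
rewrite (big_fsetD1 u) //= deg_gt0 add1n ltnS (leq_trans (degF vu)) //.
(* Sort the triples through [v] and [u] by their unique third vertex [w]. *)
have -> : edge_degree F [fset v; u] =
    \sum_(w <- S `\ v `\ u) \sum_(T <- F) (([fset v; u] `<=` T) && (w \in T) : nat).
  rewrite edge_degreeE exchange_big big_seq [RHS]big_seq; apply: eq_bigr => T TF.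
  case vuT: (_ `<=` T); last by rewrite big1.
  have TS := sub_support TF.
  move: vuT; rewrite fsubUset !fsub1set => /andP[vT uT].
  have -> : \sum_(w <- S `\ v `\ u) (true && (w \in T) : nat) =
            \sum_(w <- S `\ v `\ u) (w \in T `\ v `\ u : nat).
    rewrite big_seq [RHS]big_seq; apply: eq_bigr => w.
    by rewrite !inE => /and3P[-> ->].
  rewrite sum_mem_fset ?fsetSD //.
  have := F3 TF; rewrite (cardfsD1 v) vT (cardfsD1 u) !inE uv uT /=.
  by case: #|` _ | => [|[|]].
rewrite big_seq [leqRHS]big_seq; apply: leq_sum => w.
rewrite !inE => /and3P[wu wv wS].
(* For each [w] there is at most one such triple, and if it exists, [w] is a neighbour of [v]. *)
have [/hasP[T TF]|/hasPn noT] := boolP (has (fun T => ([fset v; u] `<=` T) && (w \in T)) F); last first.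
  by rewrite big_seq big1 // => T /noT /negPf->.
rewrite fsubUset !fsub1set -andbA => /and3P[vT uT wT].
have -> : 0 < edge_degree F [fset v; w].
  by rewrite edge_degree_gt0; apply/hasP; exists T; rewrite // fsubUset !fsub1set vT.
rewrite (bigD1_seq T) ?fset_uniq //= big_seq_cond big1 ?addn0 ?leq_b1 // => U /andP[UF UT].
apply/eqP; rewrite eqb0 fsubUset !fsub1set; apply: contra UT => /andP[/andP[vU uU] wU].
have c3 : #|` [fset v; u; w]| = 3.
  by rewrite fsetUC cardfsU1 cardfs2 !inE negb_or wv wu eq_sym uv.
have eqW X : X \in F -> v \in X -> u \in X -> w \in X -> [fset v; u; w] = X.
  move=> XF vX uX wX; apply/eqP; rewrite eqEfcard c3 (F3 XF) andbT.
  by rewrite !fsubUset !fsub1set vX uX.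
by rewrite -(eqW U) // -(eqW T).
Qed.

(** By the previous lemma [v] has at least [k + 1] neighbours, and each of the edges to them has
    degree at least [k]; the sum of these degrees counts every triple through [v] twice. *)
Lemma star_ge v : v \in S -> k * k.+1 <= 2 * \sum_(T <- F) (v \in T : nat).
Proof.
move=> vS; rewrite -sum_link_degree.
apply: (@leq_trans (k * \sum_(u <- S `\ v) (0 < edge_degree F [fset v; u] : nat))).
  by rewrite leq_mul2l link_vertices_ge ?orbT.
rewrite big_distrr /= big_seq [leqRHS]big_seq; apply: leq_sum => u.
rewrite !inE => /andP[uv uS]; case: ltnP => [deg_gt0|]; last by rewrite muln0.
rewrite muln1; apply: degF; apply/support_edgeP; rewrite cardfs2 eq_sym uv.
by split=> //; apply/hasP; rewrite -edge_degree_gt0.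
Qed.

(** Sum [star_ge] over all vertices. The factor 6 is the 2 of [star_ge] times the three vertices of
    a triple. *)
Lemma triples_ge : #|` S| * (k * k.+1) <= 6 * #|` F|.
Proof.
have -> : 6 * #|` F| = \sum_(v <- S) 2 * \sum_(T <- F) (v \in T : nat).
  rewrite -big_distrr exchange_big /= (_ : 6 = 2 * 3) // -mulnA; congr (_ * _).
  rewrite card_fset_sum1 big_distrr /= big_seq [RHS]big_seq.
  by apply: eq_bigr => T TF; rewrite sum_mem_fset ?sub_support // (F3 TF).
rewrite card_fset_sum1 big_distrl /= big_seq [leqRHS]big_seq.
by apply: leq_sum => v vS; rewrite mul1n star_ge.
Qed.

Lemma triples_le : #|` F| <= 'C(#|` S|, 3).
Proof.
rewrite -card_fset_draws; apply/fsubset_leq_card/fsubsetP => T TF.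
by rewrite !inE fpowersetE (F3 TF) sub_support.
Qed.

End Counting.

(** * The complete family of triples and its spectrum *)

Lemma sum_delta_seq (R : pzRingType) (I : eqType) (s : seq I) (x : I) (g : I -> R) :
  uniq s -> x \in s -> \sum_(i <- s) (i == x)%:R * g i = g x.
Proof.
move=> us xs; rewrite (bigD1_seq x) //= eqxx mul1r big1 ?addr0 // => i /negPf->.
by rewrite mul0r.
Qed.

Section CompleteComplex.
Local Open Scope fset_scope.
Local Open Scope ring_scope.
Variables (R : realType) (d : Order.disp_t) (V : orderType d).
Implicit Types (T e : {fset V}).

Lemma sort_fset2 (a b : V) : (a < b)%O -> sort <=%O (enum_fset [fset a; b]) = [:: a; b].
Proof.
move=> ab; apply: lt_sorted_eq; rewrite /= ?ab ?sort_lt_sorted ?fset_uniq //.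
by move=> x; rewrite mem_sort !inE.
Qed.

Lemma sort_fset3 (a b c : V) : (a < b)%O -> (b < c)%O ->
  sort <=%O (enum_fset [fset a; b; c]) = [:: a; b; c].
Proof.
move=> ab bc; apply: lt_sorted_eq; rewrite /= ?ab ?bc ?sort_lt_sorted ?fset_uniq //.
by move=> x; rewrite mem_sort !inE orbA.
Qed.

Lemma triple_pairs_neq (a b c : V) : (a < b)%O -> (b < c)%O ->
  [/\ [fset a; b] != [fset b; c], [fset a; b] != [fset a; c]
    & [fset b; c] != [fset a; c]].
Proof.
move=> ab bc; have ac := lt_trans ab bc; split.
- by apply/eqP => /fsetP/(_ a); rewrite !inE eqxx (lt_eqF ab) (lt_eqF ac).
- apply/eqP => /fsetP/(_ b); rewrite !inE eqxx (lt_eqF bc) orbT.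
  by rewrite eq_sym (lt_eqF ab).
- by apply/eqP => /fsetP/(_ a); rewrite !inE eqxx (lt_eqF ab) (lt_eqF ac).
Qed.

(** This linear form splits a sum over edges into three sums that [sum_delta_seq] evaluates. *)
Lemma incidence_fset3 (a b c : V) e : (a < b)%O -> (b < c)%O ->
  incidence R [fset a; b; c] e = (e == [fset a; b])%:R
    + (e == [fset b; c])%:R - (e == [fset a; c])%:R.
Proof.
move=> ab bc; rewrite /incidence sort_fset3 //.
have [neq1 neq2 neq3] := triple_pairs_neq ab bc.
have [->|_] := eqVneq e [fset a; b].
  by rewrite (negPf neq1) (negPf neq2) /= addr0 subr0.
have [->|_] := eqVneq e [fset b; c].
  by rewrite (negPf neq3) /= add0r subr0.
by case: eqP => _; rewrite /= add0r sub0r ?oppr0.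
Qed.

(** The matrix entry at [e] and [v] of the vertex coboundary [d_0], with edges oriented from the
    smaller to the larger endpoint. *)
Definition vertex_sign (v : V) e : R :=
  if sort <=%O (enum_fset e) is [:: a; b] then (v == b)%:R - (v == a)%:R else 0.

Lemma vertex_sign_fset2 (v a b : V) : (a < b)%O ->
  vertex_sign v [fset a; b] = (v == b)%:R - (v == a)%:R.
Proof. by move=> ab; rewrite /vertex_sign sort_fset2. Qed.

Variable S : {fset V}.
Definition complete_family : {fset {fset V}} :=
  [fset T in fpowerset S | #|` T| == 3%N].
Let F := complete_family.

Lemma mem_complete T : (T \in F) = (T `<=` S) && (#|` T| == 3%N).
Proof. by rewrite !inE fpowersetE. Qed.

Lemma complete_triple : triple_family F.
Proof. by move=> T; rewrite mem_complete => /andP[_ /eqP]. Qed.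

Lemma complete_edge_sub e : e \in support_edges F -> #|` e| = 2%N /\ e `<=` S.
Proof.
case/support_edgeP=> e2 [T]; rewrite mem_complete => /andP[TS _] eT.
by split=> //; apply: fsubset_trans TS.
Qed.

(** The triples through [e] correspond to the vertices [w] of [S] outside [e], by adjoining [w]. *)
Lemma complete_degree e : #|` e| = 2%N -> e `<=` S ->
  edge_degree F e = (#|` S| - 2)%N.
Proof.
move=> e2 eS; rewrite -e2 -cardfsDS // /edge_degree -size_filter.
have <- : #|` [fset w |` e | w in S `\` e]| = #|` S `\` e|.
  apply: card_in_imfset => w w'; rewrite !inE => /andP[we _] /andP[w'e _].
  move=> /fsetP/(_ w); rewrite !inE eqxx (negPf we) !orbF => /esym ww'.
  exact/eqP.
apply: perm_size; apply: uniq_perm; rewrite ?filter_uniq ?fset_uniq // => T.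
rewrite mem_filter mem_complete; apply/idP/imfsetP => /=.
  case/and3P=> eT TS /eqP T3.
  have /cardfs1P[w Tw] : #|` T `\` e| == 1%N by rewrite cardfsDS // T3 e2.
  have : w \in T `\` e by rewrite Tw inE.
  rewrite inE => /andP[we wT]; exists w.
    by rewrite !inE we (fsubsetP TS).
  by rewrite -Tw fsetUC fsetUDl fsetDv fsetD0; apply/esym/fsetUidPr.
case=> w; rewrite !inE => /andP[we wS] ->.
by rewrite fsubsetUr fsubUset fsub1set wS eS cardfsU1 we e2.
Qed.

Lemma sum_vertex_sign (a b : V) (g : V -> R) : (a < b)%O -> a \in S -> b \in S ->
  \sum_(v <- S) vertex_sign v [fset a; b] * g v = g b - g a.
Proof.
move=> ab aS bS; under eq_bigr do rewrite vertex_sign_fset2 // mulrBl.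
by rewrite sumrB !sum_delta_seq ?fset_uniq.
Qed.

(** The identity [d_1 d_0 = 0]: around a triple the differences (b - a) + (c - b) - (c - a)
    cancel. *)
Lemma coboundary_sqr0 T v : T \in F ->
  \sum_(e <- support_edges F) incidence R T e * vertex_sign v e = 0.
Proof.
move=> TF; have T3 := complete_triple TF.
have [a [b [c [ab bc _ TE]]]] := sorted_tripleE T3.
have ac := lt_trans ab bc.
have inE2 x y : x \in T -> y \in T -> (x < y)%O -> [fset x; y] \in support_edges F.
  move=> xT yT xy; apply/support_edgeP; rewrite cardfs2 (lt_eqF xy); split=> //.
  by exists T; rewrite // fsubUset !fsub1set xT.
rewrite TE; under eq_bigr => e do rewrite (incidence_fset3 e ab bc) mulrBl mulrDl.
rewrite sumrB big_split /= !sum_delta_seq ?fset_uniq ?inE2 //;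
  try by rewrite TE !inE eqxx ?orbT.
by rewrite !vertex_sign_fset2 //; ring.
Qed.

(** The entrywise form of [M = N - d_0 d_0^T] with [N] the size of [S]. Equal edges give [N - 2].
    Edges sharing one vertex span a triple of the family, and the signs are compared directly.
    Disjoint edges give zero on both sides. *)
Lemma complete_gram_entry e e' : e \in support_edges F -> e' \in support_edges F ->
  gram_entry R F e e' = #|` S|%:R * (e == e')%:R
    - \sum_(v <- S) vertex_sign v e * vertex_sign v e'.
Proof.
move=> /complete_edge_sub[e2 eS] /complete_edge_sub[e'2 e'S].
have F3 := complete_triple.
have [a [b [ab eE]]] := sorted_pairE e2.
have [aS bS] : a \in S /\ b \in S.
  by move: eS; rewrite eE fsubUset !fsub1set => /andP[].
have -> : \sum_(v <- S) vertex_sign v e * vertex_sign v e' =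
          vertex_sign b e' - vertex_sign a e'.
  by rewrite eE sum_vertex_sign.
have [<-|ee'] := eqVneq e e'.
  rewrite gram_entry_diag // complete_degree // eE !vertex_sign_fset2 //.
  rewrite !eqxx (lt_eqF ab) (gt_eqF ab) natrB; last by rewrite -e2 fsubset_leq_card.
  by rewrite /=; ring.
rewrite mulr0 sub0r gram_entry_off //; case: ifPn => UF.
  have [x [y [z [xy yz _ UE]]]] := sorted_tripleE (F3 _ UF).
  have xz := lt_trans xy yz.
  have eqs2 u v : (u < v)%O -> e = [fset u; v] -> a = u /\ b = v.
    move=> uv ee; move: (sort_fset2 ab); rewrite -eE ee sort_fset2 //.
    by case.
  rewrite !UE !incidence_fset3 //.
  have := fsubsetUl e e'; have := fsubsetUr e e'.
  rewrite UE => /(pair_in_triple e'2) h' /(pair_in_triple e2) h.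
  have [neq1 neq2 neq3] := triple_pairs_neq xy yz.
  have neqs := (negPf neq1, negPf neq2, negPf neq3).
  have neqs' := (lt_eqF xy, lt_eqF yz, lt_eqF xz, gt_eqF xy, gt_eqF yz, gt_eqF xz).
  (* Of the nine positions of [e] and [e'] in the triple, three contradict [e != e']; the other six
     are sign checks. *)
  case: h => he; have [] := eqs2 _ _ _ he => // -> ->; case: h' => he';
    move: ee'; rewrite he he' ?eqxx // => _;
    rewrite !vertex_sign_fset2 // ?eqxx ?neqs ?[_ == [fset x; y]]eq_sym
     ?[[fset x; z] == _]eq_sym ?neqs ?neqs' /=; ring.
(* The family contains every triple in [S], so a union outside it does not have three elements; the
   two distinct edges are thus disjoint. *)
have U3 : #|` e `|` e'| != 3%N.
  by apply: contraNneq UF => U3; rewrite mem_complete fsubUset eS e'S U3.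
have disj v : v \in e -> vertex_sign v e' = 0.
  move=> ve; have ve' : v \notin e'.
    apply: contra U3 => ve'; rewrite eqn_leq; apply/andP; split.
      have : (0 < #|` e `&` e'|)%N.
        by rewrite cardfs_gt0; apply/fset0Pn; exists v; rewrite inE ve.
      by have := cardfsUI e e'; rewrite e2 e'2; lia.
    exact: pairsU_card_gt2.
  have [x [y [xy e'E]]] := sorted_pairE e'2; move: ve'; rewrite e'E.
  rewrite vertex_sign_fset2 // !inE negb_or => /andP[/negPf-> /negPf->].
  by rewrite subrr.
by rewrite !disj ?subrr ?oppr0 // eE !inE eqxx ?orbT.
Qed.

(** Multiply [M = N - d_0 d_0^T] by [M]: the second term vanishes because [d_0^T M] contains the
    factor [(d_1 d_0)^T = 0]. *)
Lemma complete_gram_sqr :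
  let M := (delta1 R F)^T *m delta1 R F in M *m M = #|` S|%:R *: M.
Proof.
move=> M; apply/matrixP => j k; rewrite !mxE -/M.
set e := val (enum_val j); set e'' := val (enum_val k).
have eE : e \in support_edges F := valP (enum_val j).
have -> : \sum_i M j i * M i k =
    \sum_(e' <- support_edges F) gram_entry R F e e' * gram_entry R F e' e''.
  by rewrite -big_enum_fset; apply: eq_bigr => i _; rewrite !gram_entryE.
have -> : \sum_(e' <- support_edges F) gram_entry R F e e' * gram_entry R F e' e'' =
    \sum_(e' <- support_edges F) (e' == e)%:R * (#|` S|%:R * gram_entry R F e' e'')
    - \sum_(v <- S) vertex_sign v e * \sum_(e' <- support_edges F)
        vertex_sign v e' * gram_entry R F e' e''.
  under [X in _ = _ - X]eq_bigr do rewrite mulr_sumr.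
  rewrite exchange_big -sumrB /= big_seq [RHS]big_seq; apply: eq_bigr => e' e'E.
  rewrite complete_gram_entry // mulrBl mulr_suml eq_sym.
  by congr (_ - _); [ring|apply: eq_bigr => v _; rewrite mulrA].
rewrite sum_delta_seq ?fset_uniq // [X in _ - X]big1 ?subr0; last first.
  move=> v _; rewrite (_ : \sum_(e' <- _) _ = 0) ?mulr0 //.
  under eq_bigr do rewrite mulr_sumr.
  rewrite exchange_big /= big_seq big1 // => T TF.
  under eq_bigr => e' do rewrite mulrA [vertex_sign _ _ * _]mulrC.
  by rewrite -mulr_suml coboundary_sqr0 // mul0r.
by rewrite -gram_entryE mxE.
Qed.

(** From [M ^ 2 = N M], every eigenvalue is 0 or [N], and any nonzero row of [M] is an eigenvector
    for [N]. *)
Lemma lambda_complete : (2 < #|` S|)%N -> lambda R F = #|` S|%:R.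
Proof.
move=> S3; have := complete_gram_sqr.
set M := (delta1 R F)^T *m delta1 R F => /= MM.
have N0 : #|` S|%:R != 0 :> R by rewrite pnatr_eq0; lia.
have eig x : eigenvalue M x -> 0 < x -> x = #|` S|%:R.
  case/eigenvalueP=> v vM v0 x_gt0.
  have := congr1 (mulmx v) MM; rewrite mulmxA vM -scalemxAl -scalemxAr vM.
  rewrite !scalerA => /eqP; rewrite -subr_eq0 -scalerBl scaler_eq0 (negPf v0) orbF.
  by rewrite -mulrBl mulf_eq0 (gt_eqF x_gt0) orbF subr_eq0 => /eqP.
have [T TF] : exists T, T \in F.
  apply/fset0Pn; rewrite -cardfs_gt0 card_fset_draws bin_gt0 //.
have [a [b [c [ab bc _ TE]]]] := sorted_tripleE (complete_triple TF).
have eE : [fset a; b] \in support_edges F.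
  apply/support_edgeP; rewrite cardfs2 (lt_eqF ab); split=> //.
  by exists T; rewrite // TE fsubsetUl.
pose j : 'I_#|{: support_edges F}| := enum_rank [` eE].
have [e2 eS] := complete_edge_sub eE.
have Mjj : M j j != 0.
  rewrite /M gram_entryE enum_rankK gram_entry_diag //; last exact: complete_triple.
  by rewrite complete_degree // pnatr_eq0; lia.
have eigN : eigenvalue M #|` S|%:R.
  apply/eigenvalueP; exists (row j M); first by rewrite -row_mul MM linearZ.
  by apply: contra Mjj => /eqP/rowP/(_ j); rewrite !mxE => /eqP.
rewrite /lambda /set_min; set A := (X in xget _ X).
have /(xgetPex 0) [[]] : exists x, A x; last by move=> Mx x_gt0 _; apply: eig.
exists #|` S|%:R; split; first by split; rewrite // lt_def N0 /=.
by move=> x [/eig Mx /Mx->].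
Qed.

End CompleteComplex.

(** * Values of [phi] and bounds on [Hmin] *)

Lemma bin3E n : ('C(n, 3) * 6 = n * n.-1 * n.-2)%N.
Proof. by rewrite (bin_ffact n 3) !ffactnS ffactn0 muln1 mulnA. Qed.

Section Phi.
Local Open Scope fset_scope.
Local Open Scope ring_scope.
Variable R : realType.

(** Here [k + 1 < lambda <= deg + 2], so the integer [deg] is at least [k] for every edge. *)
Lemma triples_ge_of_lambda (d : Order.disp_t) (V : orderType d)
    (F : {fset {fset V}}) (k : nat) :
  triple_family F -> k%:R + 1 < lambda R F ->
  (#|` support_vertices F| * (k * k.+1) <= 6 * #|` F|)%N.
Proof.
move=> F3 lk; apply: triples_ge => // e eE.
have := lt_le_trans lk (lambda_le_degree R F3 eE).
by rewrite natr1 -natrD ltr_nat; lia.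
Qed.

(** The assumption [0 <= x] excludes the default value 0 of [phi], so the maximum is attained by a
    family. *)
Lemma phi_gt_triples (t : nat) (x : R) : 0 <= x -> x < phi R t ->
  exists (d : Order.disp_t) (V : orderType d) (F : {fset {fset V}}),
    [/\ triple_family F, #|` F| = t & x < lambda R F].
Proof.
move=> x_ge0; rewrite /phi /set_max; case: xgetP => [y _ [Ay _] xy|_]; last first.
  by rewrite ltNge x_ge0.
by case: Ay xy => d [V [F [F3 Ft ->]]] xy; exists d, V, F.
Qed.

(** With [k = n - 2] and [N >= n + 1] vertices, the double count gives [(n + 1)(n - 1)(n - 2) <= n(n
    - 1)(n - 2) + 6s]. *)
Lemma phi_excess_ge (n s : nat) : (2 <= n)%N -> (0 < s)%N ->
  n%:R - 1 < phi R ('C(n, 3) + s) -> (n.-1 * n.-2 <= 6 * s)%N.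
Proof.
move=> n2 s_gt0 /phi_gt_triples[|d [V [F [F3 Ft]]]].
  by rewrite subr_ge0 ler1n; lia.
have -> : n%:R - 1 = (n - 2)%:R + 1 :> R by rewrite natrB //; ring.
move/(triples_ge_of_lambda F3); have := triples_le F3; rewrite Ft.
set N := #|` _| => tN.
(* At most [n] vertices would carry at most ['C(n, 3)] triples, fewer than the family has as
   [s > 0]. *)
have nN : (n < N)%N.
  rewrite ltnNge; apply/negP => /(leq_bin2l 3) /(leq_trans tN); lia.
have := bin3E n; rewrite mulnDr [(6 * 'C(_, _))%N]mulnC => ->.
have [m nE] : exists m, n = m.+2 by exists n.-2; lia.
rewrite nE subn2 /= in nN * => h; have := leq_mul nN (leqnn (m * m.+1)%N).
move: h; nia.
Qed.

Lemma phi_bin (n : nat) : (2 <= n)%N -> phi R 'C(n.+1, 3) = n.+1%:R.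
Proof.
move=> n2; rewrite /phi /set_max; set A := (X in (X `&` _)%classic).
(* If [lambda] exceeded [n + 1], the double count with [k = n] would leave at most [n] vertices, too
   few for ['C(n.+1, 3)] triples. *)
have Aub x : A x -> x <= n.+1%:R.
  case=> d [V [F [F3 Ft ->]]]; rewrite leNgt -natr1; apply/negP.
  move/(triples_ge_of_lambda F3); have := triples_le F3.
  rewrite Ft [(6 * _)%N]mulnC bin3E /=; set N := #|` _| => tN h.
  have Nn : (N <= n)%N.
    have : (N * (n * n.+1) <= n * (n * n.+1))%N by move: h; nia.
    by rewrite leq_pmul2r; lia.
  have := leq_trans tN (leq_bin2l 3 Nn); rewrite binS.
  have : (0 < 'C(n, 2))%N by rewrite bin_gt0.
  lia.
have AN : A n.+1%:R.
  pose S : {fset 'I_n.+1} := [fset i | i in 'I_n.+1].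
  have cS : #|` S| = n.+1 by rewrite card_imfset //= -cardE card_ord.
  exists _, 'I_n.+1, (complete_family S); split.
  - exact: complete_triple.
  - by rewrite card_fset_draws cS.
  - by rewrite lambda_complete cS.
have [Ax ubx] : (A `&` ubound A)%classic (xget 0 (A `&` ubound A)%classic).
  by apply: xgetPex; exists n.+1%:R.
by apply/eqP; rewrite eq_le Aub ?ubx.
Qed.

Lemma Hmin_bounds (n : nat) : (2 <= n)%N ->
  (n.-1 * n.-2 <= 6 * Hmin R n)%N /\ (Hmin R n <= 'C(n, 2))%N.
Proof.
move=> n2; rewrite /Hmin /set_min; set A := (X in (X `&` _)%classic).
(* By Pascal's rule ['C(n, 3) + 'C(n, 2)] is ['C(n.+1, 3)], where [phi] equals [n + 1]. *)
have AC : A 'C(n, 2).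
  split; first by rewrite bin_gt0.
  by rewrite -binS phi_bin // -natr1; lra.
(* The set is nonempty, so a least element exists and [Hmin] is not its default value. *)
have /(xgetPex 0%N) [[H_gt0 Hphi] Hmin] : exists s, (A `&` lbound A)%classic s.
  have exA : exists s, `[< A s >] by exists 'C(n, 2); apply/asboolP.
  exists (ex_minn exA); case: ex_minnP => s /asboolP As smin; split => //.
  by move=> u Au; rewrite leEnat; apply/smin/asboolP.
by split; [exact: phi_excess_ge Hphi|rewrite -leEnat; apply: Hmin].
Qed.

End Phi.

(** * Asymptotic form of the bounds *)

Lemma eqTheta_squeeze (R : realType) (f g : nat -> R^o) (c C : R) :
    0 < c -> 0 < C -> (\forall n \near \oo, c * `|g n| <= `|f n| <= C * `|g n|) ->
  f =Theta_\oo g.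
Proof.
move=> c_gt0 C_gt0 fg; rewrite eqThetaE qualifE; apply/asboolP.
exists (c, C) => /=; first by rewrite c_gt0.
by apply: filterS fg => n /andP.
Qed.

Theorem theorem3p16 (R : realType) :
  [/\ \forall n \near \oo,
        n%:R ^+ 2 / 6 - 5 * n%:R / (2 * Num.sqrt 3) + 3 < (Hmin R n)%:R :> R
        /\ (Hmin R n <= 'C(n, 2))%N,
      (fun n : nat => (Hmin R n)%:R : R^o)
        =Theta_\oo (fun n : nat => ('C(n.+1, 3))%:R - ('C(n, 3))%:R : R^o)
    & (fun n : nat => (Hmin R n)%:R : R^o)
        =Theta_\oo (fun n : nat => n%:R ^+ 2 : R^o)].
Proof.
(* From 6 on, [n ^ 2 / 12 <= (n - 1)(n - 2) / 6] holds, which the last comparison needs. *)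
have bounds n : (6 <= n)%N -> [/\ (n%:R - 1) * (n%:R - 2) <= 6 * (Hmin R n)%:R :> R,
    (Hmin R n)%:R <= 'C(n, 2)%:R :> R & 'C(n, 2)%:R * 2 = n%:R * (n%:R - 1) :> R].
  move=> n6; have [lo up] : _ /\ _ := Hmin_bounds R (ltac:(lia) : (2 <= n)%N).
  split; last 2 first.
  - by rewrite ler_nat.
  - rewrite -natrM (bin_ffact n 2) !ffactnS ffactn0 muln1 natrM -subn1 natrB //.
    by lia.
  - move: lo; rewrite -(ler_nat R) !natrM; apply: le_trans.
    by rewrite -subn2 -subn1 !natrB //; lia.
have bin_diff n : 'C(n.+1, 3)%:R - 'C(n, 3)%:R = 'C(n, 2)%:R :> R.
  by rewrite binS natrD addrAC subrr add0r.
split.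
- exists 6%N => // n /= n6; have [lo _ _] := bounds n n6.
  split; last by case: (@Hmin_bounds R n _) => //; lia.
  have n6R : 6 <= n%:R :> R by rewrite ler_nat.
  have s3 : Num.sqrt 3 ^+ 2 = 3 :> R by rewrite sqr_sqrtr.
  have s_gt0 : 0 < Num.sqrt 3 :> R by rewrite sqrtr_gt0.
  (* Since [5 / (2 sqrt 3) = 5 sqrt 3 / 6], the strict bound amounts to
     [n (5 sqrt 3 / 6 - 1 / 2) > 8 / 3]; for [n >= 6] the estimate 17/10 is ample. *)
  have s_ge : 17 / 10 <= Num.sqrt 3 :> R.
    by rewrite leNgt; apply/negP => s_lt; move: s3; rewrite expr2; nra.
  have sV : (2 * Num.sqrt 3)^-1 = Num.sqrt 3 / 6 :> R.
    have s2_neq0 : 2 * Num.sqrt 3 != 0 :> R by rewrite mulf_neq0 ?gt_eqF.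
    apply: (mulfI s2_neq0); rewrite divff //.
    transitivity (3^-1 * Num.sqrt 3 ^+ 2 : R); last by field.
    by rewrite s3 mulVf.
  rewrite sV expr2; nra.
- apply: (@eqTheta_squeeze R _ _ 6^-1 1) => //; exists 6%N => // n /= n6.
  have [lo up binE] := bounds n n6; have n6R : 6 <= n%:R :> R by rewrite ler_nat.
  rewrite bin_diff !ger0_norm ?mul1r ?up ?andbT //; nra.
- apply: (@eqTheta_squeeze R _ _ 12^-1 1) => //; exists 6%N => // n /= n6.
  have [lo up binE] := bounds n n6; have n6R : 6 <= n%:R :> R by rewrite ler_nat.
  rewrite !ger0_norm ?mul1r ?exprn_ge0 // expr2; apply/andP; split; nra.
Qed.
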